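(* For $d\ge 2$ let $m_d=\sup\{\sigma_{d-1}(A): A\subseteq\mathbb S^{d-1}\text{ is measurable and zero-sum-free}\}$. Then $\lim_{d\to\infty} m_d=\frac12$.
   Context: $\mathbb S^{d-1}$ is the unit sphere in $\mathbb R^d$, and $\sigma_{d-1}$ is its rotation-invariant (surface) probability measure. A measurable set $A\subseteq\mathbb S^{d-1}$ is called zero-sum-free if there are no $x,y,z\in A$ with $x+y+z=0$ (sum in $\mathbb R^d$). *)

(* Defs.v *)
From HB Require Import structures.
From mathcomp Require Import all_boot all_order all_algebra.
From mathcomp Require Import all_classical all_reals all_analysis.
Set Implicit Arguments.
Unset Strict Implicit.
Unset Printing Implicit Defensive.
Import Order.TTheory GRing.Theory Num.Theory.
Import numFieldNormedType.Exports.
Local Open Scope classical_set_scope.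
Local Open Scope ring_scope.

(* R^d with its Borel sigma-algebra. *)
Definition borelRd (R : realType) (d : nat) :=
  g_sigma_algebraType (@open 'rV[R]_d).

(* The norm `|x| of a row vector is the sup norm, hence the explicit Euclidean
   equation. *)
Definition unit_sphere (R : realType) (d : nat) : set 'rV[R]_d :=
  [set x | \sum_(i < d) x ord0 i ^+ 2 = 1].

Definition rotation (R : realType) (d : nat) (M : 'M[R]_d) : Prop :=
  M *m M^T = 1%:M /\ \det M = 1.

(* Measures on S^(d-1) are represented as measures on R^d carried by the
   sphere; as the sphere is closed, its Borel sets are the Borel sets of R^d
   contained in it.  For d >= 2 exactly one probability measure satisfies this
   predicate, since the rotations act transitively on the sphere. *)
Definition sphere_measure (R : realType) (d : nat)
    (sigma : probability (borelRd R d) R) : Prop :=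
  sigma (@unit_sphere R d) = 1%E /\
  forall (M : 'M[R]_d) (A : set (borelRd R d)), rotation M -> measurable A ->
    sigma ((fun x : 'rV[R]_d => x *m M) @^-1` A) = sigma A.

Definition zero_sum_free (R : realType) (d : nat) (A : set 'rV[R]_d) : Prop :=
  ~ exists x y z, [/\ A x, A y, A z & x + y + z = 0].

Definition max_zero_sum_free (R : realType) (d : nat)
    (sigma : probability (borelRd R d) R) : \bar R :=
  ereal_sup [set sigma A | A in [set A : set (borelRd R d) |
    [/\ measurable A, A `<=` @unit_sphere R d & zero_sum_free A]]].

(* Main.v *)
Require Import Defs.
From HB Require Import structures.
From mathcomp Require Import all_boot all_order all_algebra.
From mathcomp Require Import all_classical all_reals all_analysis.
From mathcomp Require Import measurable_realfun ring lra zify.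

(** A lexicographic half of the sphere is zero-sum-free and has measure at least
1/2, since together with its antipode it covers the sphere. For the upper
bound, rotate the normalized root system of type A: the vectors
r_ij = (e_i - e_j) / sqrt 2 satisfy r_ij + r_jk + r_ki = 0, so for a
zero-sum-free A and an orthogonal M the arcs (i, j) with r_ij M in A form a
digraph on d vertices without directed triangle, which has at most d^2 / 2
arcs. Averaging over M gives d (d - 1) sigma(A) <= d^2 / 2. In place of a Haar
measure on O(d), the average is taken by induction on d: if u is uniform on the
sphere and y is uniform on the sphere one dimension below, then (s, t y) carried by
the reflection exchanging u and the pole is uniform, because the rotation-invariant
probability measure on the sphere is unique. Uniqueness follows from counting
pairs of points at small distance in two ways. *)

Set Implicit Arguments.
Unset Strict Implicit.
Unset Printing Implicit Defensive.
Import Order.TTheory GRing.Theory Num.Theory.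
Import numFieldNormedType.Exports.
Local Open Scope classical_set_scope.
Local Open Scope ring_scope.

(** * Borel sets of R^d *)

Section Borel.
Context {R : realType} {d : nat}.

Lemma borelRd_open_measurable (U : set 'rV[R]_d) :
  open U -> measurable (U : set (borelRd R d)).
Proof. by move=> oU; apply: sub_sigma_algebra. Qed.

Lemma measurable_coord (i : 'I_d) :
  measurable_fun setT (fun x : borelRd R d => (x : 'rV[R]_d) ord0 i).
Proof.
apply: (measurability _ (RGenOpens.measurableE R)).
move=> _ [_ [a [b ->] <-]]; rewrite setTI; apply: borelRd_open_measurable.
have /continuousP := @coord_continuous R 1 d ord0 i.
by apply; exact: interval_open.
Qed.

Lemma ball_rVP (x y : 'rV[R]_d) (e : R) : 0 < e ->
  ball x e y <-> forall i, `|x ord0 i - y ord0 i| < e.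
Proof.
move=> e0; split; first by move=> [_ + i] => /(_ ord0 i).
move=> xy; have : @mx_ball 1 d R R x e y; last exact.
by split=> // i j; rewrite ord1; exact: xy.
Qed.

Lemma box_mem (q : 'rV[R]_d) (r : R) (x y : 'rV[R]_d) :
  (forall i, `|x ord0 i - q ord0 i| < r) -> (forall i, `|y ord0 i - q ord0 i| < r) ->
  forall i, `|x ord0 i - y ord0 i| < r + r.
Proof.
move=> hx hy i.
rewrite -(subrKA (q ord0 i)) (le_lt_trans (ler_normD _ _))//.
by rewrite ltrD// distrC.
Qed.

Lemma open_box (U : set 'rV[R]_d) (x : 'rV[R]_d) : open U -> U x ->
  exists2 e : R, 0 < e & forall y : 'rV[R]_d, (forall i, `|x ord0 i - y ord0 i| < e) -> U y.
Proof.
rewrite openE /= => oU /oU /nbhs_ballP[e /= e0 eU].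
by exists e => [|y xy]; [exact: e0|apply: eU; exact/(ball_rVP _ _ e0)].
Qed.

(** Two points of such a box differ by less than [e] in every coordinate; being countably many, the
    rational boxes serve as a countable base. *)
Lemma ratr_box (x : 'rV[R]_d) (e : R) : 0 < e ->
  exists (q : 'rV[rat]_d) (r : rat),
    (forall i, `|x ord0 i - ratr (q ord0 i)| < ratr r) /\ ratr r + ratr r < e.
Proof.
move=> e0.
have /rat_in_itvoo[r] : 0 < e / 2 by rewrite divr_gt0.
rewrite in_itv/= => /andP[r0 re].
have h i : exists s : rat, `|x ord0 i - ratr s| < ratr r.
  have /rat_in_itvoo[s] : x ord0 i - ratr r < x ord0 i + ratr r.
    by rewrite ltrD2l gtrN.
  by rewrite in_itv/= -ltr_distlC => ?; exists s.
exists (\row_i projT1 (cid (h i))), r; split=> [i|].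
  by rewrite mxE; case: cid.
by rewrite [ltRHS]splitr ltrD.
Qed.

(** An open set is the union of the countably many rational boxes inside it, and the preimage of a
    box is a finite intersection of conditions on single coordinates. *)
Lemma measurable_fun_rV d' (T : measurableType d') (f : T -> borelRd R d) :
  (forall i, measurable_fun setT (fun z => (f z : 'rV[R]_d) ord0 i)) ->
  measurable_fun setT f.
Proof.
move=> mf; apply: (@measurability _ _ T (borelRd R d) setT f (@open 'rV[R]_d) erefl) => _ [U oU <-].
rewrite setTI.
pose box (p : 'rV[rat]_d * rat) : set 'rV[R]_d :=
  [set z | forall i, `|z ord0 i - ratr (p.1 ord0 i)| < ratr p.2].
have -> : f @^-1` U = \bigcup_(p : 'rV[rat]_d * rat)
    (if `[< box p `<=` U >] then f @^-1` box p else set0).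
  apply/seteqP; split=> [z /= Uz|z [p _]].
    have [e e0 eU] := open_box oU Uz.
    have [q [r [hr re]]] := ratr_box (f z) e0.
    exists (q, r) => //; rewrite asboolT// => y yq; apply: eU => i.
    apply: lt_trans re; apply: (@box_mem (\row_i ratr (q ord0 i))) => j;
      by rewrite mxE //; exact: yq.
  by case: asboolP => // + /= bz; apply.
apply: countable_bigcupT_measurable => [|p]; first exact: countableP.
case: ifP => // _.
have -> : f @^-1` box p = \bigcap_(i in [set: 'I_d])
    (fun z => `|(f z : 'rV[R]_d) ord0 i - ratr (p.1 ord0 i)|) @^-1`
       `]-oo, ratr p.2[%classic.
  apply/seteqP; split=> z /= h i; first by move=> _; rewrite /= in_itv/=; exact: h.
  by have := h i I; rewrite /= in_itv.
apply: fin_bigcap_measurable => // i _; rewrite -[X in measurable X]setTI.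
have mg : measurable_fun setT
    (fun z => `|(f z : 'rV[R]_d) ord0 i - ratr (p.1 ord0 i)|).
  apply: measurableT_comp => //; apply: measurable_funB => //.
by apply: mg.
Qed.

Lemma measurable_fun_mulmx (M : 'M[R]_d) :
  measurable_fun setT ((fun x : 'rV[R]_d => x *m M) : borelRd R d -> borelRd R d).
Proof.
apply: measurable_fun_rV => i.
under eq_fun do rewrite mxE.
apply: measurable_sum => j; apply: measurable_funM => //.
exact: measurable_coord.
Qed.

Lemma measurable_unit_sphere : measurable (@unit_sphere R d : set (borelRd R d)).
Proof.
have mS : measurable_fun setT
    (fun x : borelRd R d => \sum_(i < d) (x : 'rV[R]_d) ord0 i ^+ 2).
  by apply: measurable_sum => i; apply: measurable_funX; exact: measurable_coord.
have := mS measurableT [set 1] (measurable_set1 1).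
by rewrite setTI.
Qed.

End Borel.

(** * Orthogonal matrices and the sphere *)

Section Dot.
Context {R : realType} {d : nat}.
Implicit Types (x y u v w : 'rV[R]_d) (M Q : 'M[R]_d).

Definition dot x y : R := (x *m y^T) ord0 ord0.

Lemma dotE x y : dot x y = \sum_(i < d) x ord0 i * y ord0 i.
Proof. by rewrite /dot mxE; apply: eq_bigr => i _; rewrite !mxE. Qed.

Lemma dotC x y : dot x y = dot y x.
Proof. by rewrite !dotE; apply: eq_bigr => i _; rewrite mulrC. Qed.

Lemma dotDl x y w : dot (x + y) w = dot x w + dot y w.
Proof. by rewrite /dot mulmxDl mxE. Qed.

Lemma dotNl x w : dot (- x) w = - dot x w.
Proof. by rewrite /dot mulNmx mxE. Qed.

Lemma dotZl a x w : dot (a *: x) w = a * dot x w.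
Proof. by rewrite /dot -scalemxAl mxE. Qed.

Lemma dotDr x y w : dot w (x + y) = dot w x + dot w y.
Proof. by rewrite dotC dotDl !(dotC w). Qed.

Lemma dotNr x w : dot w (- x) = - dot w x.
Proof. by rewrite dotC dotNl (dotC w). Qed.

Lemma dotZr a x w : dot w (a *: x) = a * dot w x.
Proof. by rewrite dotC dotZl (dotC w). Qed.

Lemma dot_sqr x : dot x x = \sum_(i < d) x ord0 i ^+ 2.
Proof. by rewrite dotE; apply: eq_bigr => i _; rewrite expr2. Qed.

Lemma dot_ge0 x : 0 <= dot x x.
Proof. by rewrite dot_sqr sumr_ge0// => i _; exact: sqr_ge0. Qed.

Lemma dot_eq0 x : dot x x = 0 -> x = 0.
Proof.
rewrite dot_sqr => /eqP; rewrite psumr_eq0; last by move=> i _; exact: sqr_ge0.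
move=> /allP x0; apply/rowP => i; rewrite mxE; apply/eqP.
by have := x0 i (mem_index_enum i); rewrite sqrf_eq0.
Qed.

Lemma unit_sphereP x : unit_sphere x <-> dot x x = 1.
Proof. by rewrite dot_sqr. Qed.

Definition orthogonal_mx M : Prop := M *m M^T = 1%:M.

Lemma orthogonal_tr M : orthogonal_mx M -> orthogonal_mx M^T.
Proof. by rewrite /orthogonal_mx trmxK => /mulmx1C. Qed.

Lemma orthogonalM M Q : orthogonal_mx M -> orthogonal_mx Q -> orthogonal_mx (M *m Q).
Proof.
by rewrite /orthogonal_mx => hM hQ; rewrite trmx_mul mulmxA -(mulmxA M) hQ mulmx1.
Qed.

Lemma orthogonalN1 : orthogonal_mx (- 1%:M).
Proof. by rewrite /orthogonal_mx linearN /= trmx1 mulmxN mulNmx mulmx1 opprK. Qed.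

Lemma dot_orthogonal M x y : orthogonal_mx M -> dot (x *m M) (y *m M) = dot x y.
Proof. by move=> hM; rewrite /dot trmx_mul mulmxA -(mulmxA x) hM mulmx1. Qed.

Lemma unit_sphere_orthogonal M x : orthogonal_mx M ->
  unit_sphere (x *m M) <-> unit_sphere x.
Proof. by move=> hM; rewrite !unit_sphereP dot_orthogonal. Qed.

Lemma orthogonal_det M : orthogonal_mx M -> \det M = 1 \/ \det M = -1.
Proof.
move=> /(congr1 determinant); rewrite det_mulmx det_tr det1 => /eqP.
by rewrite -expr2 sqrf_eq1 => /orP[] /eqP ->; [left|right].
Qed.

(** Householder reflection in the hyperplane orthogonal to [w]. At [w = 0] it is the identity, so
    [reflection_map] also covers [u = v]. *)
Definition reflection w : 'M[R]_d := 1%:M - (2 / dot w w) *: (w^T *m w).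

Lemma mul_reflection x w :
  x *m reflection w = x - (2 / dot w w * dot x w) *: w.
Proof.
rewrite mulmxBr mulmx1; congr (_ - _).
rewrite -scalemxAr mulmxA -scalerA; congr (_ *: _).
by rewrite (mx11_scalar (x *m w^T)) mul_scalar_mx.
Qed.

Lemma reflection_tr w : (reflection w)^T = reflection w.
Proof. by rewrite linearB /= trmx1 linearZ /= trmx_mul trmxK. Qed.

Lemma reflection_orthogonal w : orthogonal_mx (reflection w).
Proof.
rewrite /orthogonal_mx reflection_tr; apply/row_matrixP => i.
rewrite !rowE mulmxA !mul_reflection mulmx1 dotDl dotNl dotZl.
set e := delta_mx _ _.
have [w0|w0] := eqVneq (dot w w) 0; first by rewrite (dot_eq0 w0) !scaler0 !subr0.
rewrite -addrA -opprD -scalerDl -mulrDr addrA -mulr2n.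
rewrite [X in X *: _](_ : _ = 0) ?scale0r ?subr0//.
apply/eqP; rewrite mulf_eq0; apply/orP; right.
by rewrite mulrAC divfK// mulr_natl subrr.
Qed.

Lemma reflection_map u v : unit_sphere u -> unit_sphere v ->
  u *m reflection (u - v) = v.
Proof.
rewrite !unit_sphereP => hu hv; rewrite mul_reflection.
have [w0|w0] := eqVneq (dot (u - v) (u - v)) 0.
  by have /subr0_eq uv := dot_eq0 w0; rewrite uv subrr scaler0 subr0.
have -> : 2 / dot (u - v) (u - v) * dot u (u - v) = 1.
  have e : dot (u - v) (u - v) = 2 * dot u (u - v).
    rewrite !(dotDl, dotDr, dotNl, dotNr) hu hv (dotC v u); ring.
  by rewrite mulrAC -e divff.
by rewrite scale1r subKr.
Qed.

End Dot.

Lemma rotation_transitive (R : realType) d (x y : 'rV[R]_d) : (2 <= d)%N ->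
  unit_sphere x -> unit_sphere y -> exists2 M, rotation M & x *m M = y.
Proof.
case: d x y => [//|[//|d]] x y _ ux uy.
have oQ := reflection_orthogonal (x - y).
have xQ := reflection_map ux uy.
have [dQ|dQ] := orthogonal_det oQ; first by exists (reflection (x - y)).
(* The reflection now has determinant -1, so it is preceded by a map of determinant -1 fixing [x]:
   the conjugate by [P] of the sign change [D] of the last coordinate. [D] fixes [e0] because there
   are at least two coordinates. *)
pose e0 : 'rV[R]_d.+2 := delta_mx ord0 ord0.
have ue0 : unit_sphere e0.
  apply/unit_sphereP; rewrite /dot trmx_delta mul_delta_mx_cond eqxx mulr1n.
  by rewrite mxE !eqxx.
pose P := reflection (x - e0).
pose D : 'M[R]_d.+2 := diag_mx (\row_j (if j == ord_max then -1 else 1)).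
have oD : orthogonal_mx D.
  rewrite /orthogonal_mx tr_diag_mx mulmx_diag -diag_const_mx; congr diag_mx.
  by apply/rowP => j; rewrite !mxE; case: ifP; rewrite ?mulrNN mulr1.
have e0D : e0 *m D = e0.
  by rewrite -rowE row_diag_mx mxE /= scale1r.
have dD : \det D = -1.
  rewrite det_diag (bigD1 ord_max)//= mxE eqxx big1 ?mulr1// => i /negbTE h.
  by rewrite mxE h.
have oP : orthogonal_mx P := reflection_orthogonal _.
have xP : x *m P = e0 by exact: reflection_map.
exists (P *m D *m P^T *m reflection (x - y)).
  split; first by do ?apply: orthogonalM => //; exact: orthogonal_tr.
  rewrite !det_mulmx det_tr dQ dD !mulrN1 mulNr opprK.
  by rewrite -{2}det_tr -det_mulmx oP det1.
by rewrite !mulmxA xP e0D -{1}xP -!mulmxA (mulmxA P) oP mul1mx.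
Qed.

(** * Uniqueness of the rotation-invariant measure *)

Lemma probability_setI1 d (T : measurableType d) (R : realType)
    (P : probability T R) (A S : set T) : measurable A -> measurable S ->
  P S = 1%E -> P (A `&` S) = P A.
Proof.
move=> mA mS PS; rewrite [RHS](measureDI P mA mS) -[LHS]add0e; congr (_ + _)%E.
have PSC : P (~` S) = 0%E by rewrite probability_setC// PS subee.
apply/esym/eqP; rewrite -measure_le0 -PSC le_measure ?inE//.
  exact: measurableD.
exact: measurableC.
Qed.

Lemma fubini_sections d1 d2 (T1 : measurableType d1) (T2 : measurableType d2)
    (R : realType) (P : probability T1 R) (Q : probability T2 R)
    (E : set (T1 * T2)) : measurable E ->
  (\int[P]_x Q (xsection E x) = \int[Q]_y P (ysection E y))%E.
Proof.
move=> mE; have := indic_fubini_tonelli P Q mE.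
by rewrite indic_fubini_tonelli_FE// indic_fubini_tonelli_GE.
Qed.

Section Caps.
Context {R : realType} {d : nat}.
Hypothesis d2 : (2 <= d)%N.
Implicit Types (mu nu : probability (borelRd R d) R) (x y : 'rV[R]_d).

(** Here [e] bounds the squared Euclidean distance. These balls, unlike the sup-norm ones, are
    preserved by rotations. *)
Definition euclid_ball (x : 'rV[R]_d) (e : R) : set (borelRd R d) :=
  [set y : 'rV[R]_d | dot (x - y) (x - y) < e].

Lemma measurable_dist_lt (e : R) : measurable
  [set z : borelRd R d * borelRd R d |
     dot ((z.1 : 'rV[R]_d) - z.2) ((z.1 : 'rV[R]_d) - z.2) < e].
Proof.
pose f (z : borelRd R d * borelRd R d) :=
  dot ((z.1 : 'rV[R]_d) - z.2) ((z.1 : 'rV[R]_d) - z.2).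
have mf : measurable_fun setT f.
  rewrite /f; under eq_fun do rewrite dot_sqr.
  apply: measurable_sum => i; apply: measurable_funX.
  under eq_fun do rewrite !mxE.
  apply: measurable_funB.
    by apply: (measurableT_comp (measurable_coord i)); exact: measurable_fst.
  by apply: (measurableT_comp (measurable_coord i)); exact: measurable_snd.
rewrite (_ : [set _ | _] = setT `&` f @^-1` `]-oo, e[%classic); first exact: mf.
by rewrite setTI; apply/seteqP; split=> z; rewrite /= in_itv.
Qed.

Lemma measurable_euclid_ball x e : measurable (euclid_ball x e).
Proof.
rewrite (_ : euclid_ball x e = xsection [set z : borelRd R d * borelRd R d |
     dot ((z.1 : 'rV[R]_d) - z.2) ((z.1 : 'rV[R]_d) - z.2) < e] x).
  by apply: measurable_xsection; exact: measurable_dist_lt.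
by apply/seteqP; split=> y; rewrite xsectionE.
Qed.

Lemma cap_const mu x y e : sphere_measure mu -> unit_sphere x -> unit_sphere y ->
  mu (euclid_ball x e) = mu (euclid_ball y e).
Proof.
move=> [_ muR] ux uy; have [M rM xM] := rotation_transitive d2 ux uy.
rewrite -(muR M (euclid_ball y e))//; last exact: measurable_euclid_ball.
congr (mu _); apply/seteqP; split=> z;
  by rewrite /euclid_ball /= -xM -mulmxBl dot_orthogonal//; case: rM.
Qed.


(** Inner parallel set of [U] in the sup norm. For open [U] these sets increase to [U] as [e] tends
    to 0. *)
Definition inner_nbhd (U : set 'rV[R]_d) (e : R) : set (borelRd R d) :=
  [set x : 'rV[R]_d | forall y : 'rV[R]_d,
     (forall i, `|x ord0 i - y ord0 i| < e) -> U y].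

Lemma measurable_inner_nbhd (U : set 'rV[R]_d) (e : R) : 0 < e ->
  measurable (inner_nbhd U e).
Proof.
move=> e0.
rewrite (_ : inner_nbhd U e = ~` \bigcup_(y in ~` U) (ball y e : set 'rV[R]_d)).
  apply: measurableC; apply: borelRd_open_measurable; apply: bigcup_open => y _.
  exact: ball_open.
apply/seteqP; split => x /=.
  move=> xU [y Uy] /ball_sym /(ball_rVP _ _ e0) xy; apply: Uy; exact: xU.
move=> xU y /(ball_rVP _ _ e0) xy; apply: contrapT => Uy; apply: xU.
by exists y => //; exact: ball_sym.
Qed.

(** Both sides come from the product measure of the pairs [(x, y)] on the sphere at distance less
    than [e] with [x] in the inner neighbourhood. Integrating over [y] first gives the left side
    exactly; integrating over [x] first, only [y] in [U] contribute, each at most the measure of a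
    cap. *)
Lemma cap_double_counting mu nu (o : 'rV[R]_d) (U : set 'rV[R]_d) (e : R) :
  sphere_measure mu -> sphere_measure nu -> unit_sphere o -> open U -> 0 < e ->
  (nu (euclid_ball o (e ^+ 2)) * mu (inner_nbhd U e) <=
   mu (euclid_ball o (e ^+ 2)) * nu (U : set (borelRd R d)))%E.
Proof.
move=> hmu hnu uo oU e0.
have mS := @measurable_unit_sphere R d.
have mV := measurable_inner_nbhd U e0.
have mU := borelRd_open_measurable oU.
have mB x := measurable_euclid_ball x (e ^+ 2).
pose S : set (borelRd R d) := @unit_sphere R d.
pose E := [set z : borelRd R d * borelRd R d |
     dot ((z.1 : 'rV[R]_d) - z.2) ((z.1 : 'rV[R]_d) - z.2) < e ^+ 2] `&`
   ((inner_nbhd U e `&` S) `*` S).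
have mE : measurable E.
  apply: measurableI; first exact: measurable_dist_lt.
  by apply: measurableX => //; exact: measurableI.
(* Each coordinate difference is at most the Euclidean distance. *)
have near_U x y : inner_nbhd U e x -> euclid_ball x (e ^+ 2) y -> U y.
  move=> xU xy; apply: xU => i.
  rewrite -(ltr_pXn2r (n := 2))// ?nnegrE// ?(ltW e0)//.
  apply: le_lt_trans xy; rewrite dot_sqr (bigD1 i)//= !mxE.
  rewrite real_normK ?num_real// lerDl sumr_ge0// => j _; exact: sqr_ge0.
have <- : (\int[mu]_x nu (xsection E x) =
    nu (euclid_ball o (e ^+ 2)) * mu (inner_nbhd U e))%E.
  rewrite -(probability_setI1 mV mS); last by case: hmu.
  rewrite -[RHS]integral_cst; last exact: measurableI.
  rewrite [RHS]integral_mkcond; apply: eq_integral => x _.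
  rewrite patchE; case: ifPn => [|/negP xV].
    rewrite inE => -[xV xS].
    rewrite -(cap_const _ hnu xS uo) -(probability_setI1 (mB x) mS); last by case: hnu.
    congr (nu _); apply/seteqP; split => y; rewrite xsectionE /E /=.
      by move=> [? [_ ?]].
    by move=> [].
  rewrite (_ : xsection E x = set0) ?measure0// -subset0 => y.
  by rewrite xsectionE /E /= => -[_ [? _]]; apply: xV; rewrite inE.
rewrite fubini_sections//.
rewrite -[leRHS]integral_cst// [leRHS]integral_mkcond; apply: ge0_le_integral => //.
- exact: measurable_fun_ysection.
- apply/(measurable_restrictT _ mU).
  exact: measurable_cst.
move=> y _; rewrite patchE; case: ifPn => [_|/negP yU].
  have [yS|yS] := pselect (S y).
    rewrite (cap_const _ hmu uo yS) le_measure ?inE//.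
      exact: measurable_ysection.
    move=> x; rewrite ysectionE /E /euclid_ball/= => -[].
    by rewrite -opprB dotNl dotNr opprK.
  rewrite (_ : ysection E y = set0) ?measure0// -subset0 => x.
  by rewrite ysectionE /E /= => -[_ [_ ?]]; apply: yS.
rewrite (_ : ysection E y = set0) ?measure0// -subset0 => x.
rewrite ysectionE /E /= => -[xy [[xV _] _]]; apply: yU; rewrite inE.
exact: near_U xV xy.
Qed.

(** All caps of this size have the same measure and countably many cover the sphere, so they cannot
    be null. *)
Lemma cap_gt0 mu (o : 'rV[R]_d) (e : R) : sphere_measure mu -> unit_sphere o ->
  0 < e -> (0 < mu (euclid_ball o e))%E.
Proof.
move=> hmu uo e0; rewrite lt0e measure_ge0 andbT; apply/negP => /eqP mu0.
(* With coordinate differences below [r <= 1], each square is at most [r], and the [d] squares sum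
   to less than [e]. *)
pose r : R := Num.min 1 (e / d.+1%:R).
have r0 : 0 < r by rewrite /r lt_min ltr01 divr_gt0.
pose box (p : 'rV[rat]_d * rat) : set 'rV[R]_d :=
  [set z | unit_sphere z /\ forall i, `|z ord0 i - ratr (p.1 ord0 i)| < ratr p.2].
(* A point of the sphere in the box if there is one; the default 0 is off the sphere and is
   discarded by the test in [B]. *)
pose center p := xget (0 : 'rV[R]_d) (box p).
pose B n : set (borelRd R d) := if unpickle n is Some p then
  if `[< unit_sphere (center p) >] then euclid_ball (center p) e else set0 else set0.
have B0 n : mu.-negligible (B n).
  rewrite /B; case: unpickle => [p|]; last exact: negligible_set0.
  case: asboolP => [h|_]; last exact: negligible_set0.
  apply/negligibleP; first exact: measurable_euclid_ball.
  exact: etrans (cap_const _ hmu h uo) mu0.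
have cov : (@unit_sphere R d : set (borelRd R d)) `<=` \bigcup_n B n.
  move=> x ux; have [q [s [hx sr]]] := ratr_box x r0.
  have [cu cb] : box (q, s) (center (q, s)) by apply: (@xgetPex _ _ (box (q, s))); exists x.
  exists (pickle (q, s)) => //; rewrite /B pickleK asboolT// /euclid_ball/=.
  have cx i : `|center (q, s) ord0 i - x ord0 i| < r.
    apply: lt_trans sr; apply: (@box_mem _ _ (\row_i ratr (q ord0 i))) => j;
      by rewrite mxE//; exact: cb.
  rewrite dot_sqr; apply: (@le_lt_trans _ _ (\sum_(i < d) e / d.+1%:R)).
    apply: ler_sum => i _; rewrite !mxE -(real_normK (num_real _)) expr2.
    rewrite (le_trans (y := 1 * r))//.
      by apply: ler_pM => //; apply/ltW => //; rewrite (lt_le_trans (cx i))// ge_min lexx.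
    by rewrite mul1r ge_min lexx orbT.
  rewrite sumr_const card_ord -[ltLHS]mulr_natr mulrAC ltr_pdivrMr//.
  by rewrite ltr_pM2l// ltr_nat.
have /negligibleP : mu.-negligible (@unit_sphere R d : set (borelRd R d)).
  exact: negligibleS cov (negligible_bigcup B0).
move=> /(_ (@measurable_unit_sphere R d)) muS0.
by case: hmu => /(etrans (esym muS0)) /esym/eqP; rewrite onee_eq0.
Qed.

(** Once the cap measures are cancelled, double counting bounds the [mu] measure of every inner
    neighbourhood by the [nu] measure of [U]; continuity from below concludes. *)
Lemma sphere_measure_le_open mu nu (U : set 'rV[R]_d) : sphere_measure mu ->
  sphere_measure nu -> open U ->
  (mu (U : set (borelRd R d)) <= nu (U : set (borelRd R d)))%E.
Proof.
move=> hmu hnu oU.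
have [p up] : exists o : 'rV[R]_d, unit_sphere o.
  apply/not_existsP => noS; case: hmu => + _.
  rewrite (_ : @unit_sphere R d = set0) ?measure0; last by rewrite -subset0.
  by move/esym/eqP; rewrite onee_eq0.
(* Double counting with the whole space as open set compares the caps of two sphere measures; by
   symmetry they agree. *)
have cap_le P Q (e : R) : sphere_measure P -> sphere_measure Q -> 0 < e ->
    (P (euclid_ball p (e ^+ 2)) <= Q (euclid_ball p (e ^+ 2)))%E.
  move=> hP hQ e0.
  have := cap_double_counting hQ hP up openT e0.
  rewrite (_ : inner_nbhd _ _ = setT); last by apply/seteqP; split.
  by rewrite !probability_setT !mule1.
have muV n : (mu (inner_nbhd U n.+1%:R^-1) <= nu (U : set (borelRd R d)))%E.
  have e0 : 0 < n.+1%:R^-1 :> R by rewrite invr_gt0.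
  have := cap_double_counting hmu hnu up oU e0.
  have -> : nu (euclid_ball p (n.+1%:R^-1 ^+ 2)) = mu (euclid_ball p (n.+1%:R^-1 ^+ 2)).
    by apply/eqP; rewrite eq_le !cap_le.
  rewrite lee_pmul2l//; first exact: fin_num_measure (measurable_euclid_ball _ _).
  by apply: cap_gt0 => //; rewrite exprn_gt0.
have UE : (U : set (borelRd R d)) = \bigcup_n inner_nbhd U n.+1%:R^-1.
  apply/seteqP; split => [x Ux|x [n _]]; last first.
    by apply=> i; rewrite subrr normr0 invr_gt0.
  have [e e0 eU] := open_box oU Ux.
  exists (Num.truncn e^-1) => // y xy; apply: eU => i; apply: lt_trans (xy i) _.
  rewrite invf_plt ?posrE//.
  by apply: truncnS_gt.
have mV n : measurable (inner_nbhd U n.+1%:R^-1).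
  by apply: measurable_inner_nbhd; rewrite invr_gt0.
rewrite [leLHS](congr1 mu UE).
have cV : mu (inner_nbhd U n.+1%:R^-1) @[n --> \oo] --> mu (\bigcup_n inner_nbhd U n.+1%:R^-1).
  apply: nondecreasing_cvg_mu => //; first exact: bigcupT_measurable.
  move=> m n mn; apply/subsetPset => x xV y xy; apply: xV => i.
  by apply: lt_le_trans (xy i) _; rewrite lef_pV2 ?posrE// ler_nat.
by apply: (cvge_le _ cV); exact: nearW.
Qed.

Lemma sphere_measure_unique mu nu (A : set (borelRd R d)) : sphere_measure mu ->
  sphere_measure nu -> measurable A -> mu A = nu A.
Proof.
move=> hmu hnu; apply: (@measure_unique _ R (borelRd R d)
  (@open 'rV[R]_d) (fun=> setT) erefl _ _ _ mu nu).
- exact: openI.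
- by move=> _; exact: openT.
- by rewrite bigcup_const.
- by move=> U oU; apply/eqP; rewrite eq_le !sphere_measure_le_open.
- by move=> _; rewrite [ltLHS](probability_setT mu) ltry.
Qed.

(** Conjugating a rotation by [Q] gives a rotation, so the image of [mu] under [Q] is again
    rotation-invariant, and uniqueness applies. This extends the invariance to determinant -1. *)
Lemma sphere_measure_orthogonal mu (Q : 'M[R]_d) (A : set (borelRd R d)) :
  sphere_measure mu -> orthogonal_mx Q -> measurable A ->
  mu ((fun x : 'rV[R]_d => x *m Q) @^-1` A) = mu A.
Proof.
move=> hmu oQ mA.
pose f := mfun_Sub (mem_set (@measurable_fun_mulmx R d Q)).
apply: (@sphere_measure_unique (distribution mu f)) => //; split.
  rewrite -(proj1 hmu); congr (mu _); apply/seteqP; split=> x;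
    by move=> /(unit_sphere_orthogonal x oQ).
move=> M B [oM dM] mB; rewrite /distribution /pushforward.
have rM : rotation (Q *m M *m Q^T).
  split; first by do ?apply: orthogonalM => //; exact: orthogonal_tr.
  by rewrite !det_mulmx det_tr dM mulr1 -{2}det_tr -det_mulmx oQ det1.
rewrite -[RHS](proj2 hmu _ _ rM); last first.
  rewrite -[X in measurable X]setTI; exact: measurable_fun_mulmx.
congr (mu _); apply/seteqP; split=> x /=;
  by rewrite -!mulmxA (mulmx1C oQ) mulmx1.
Qed.

End Caps.

(** * Disintegration of the sphere measure *)

Lemma eq_integral_full d (T : measurableType d) (R : realType)
    (P : probability T R) (S : set T) (f g : T -> \bar R) : measurable S ->
  P S = 1%E -> measurable_fun setT f -> measurable_fun setT g ->
  {in S, f =1 g} -> (\int[P]_x f x = \int[P]_x g x)%E.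
Proof.
move=> mS PS mf mg fg; apply: ae_eq_integral => //.
exists (~` S); split; first exact: measurableC.
  by rewrite [LHS](probability_setC P mS) PS subee.
by move=> x /= + Sx; apply=> _; apply: fg; rewrite inE.
Qed.

Section Coordinates.
Context {R : realType} {d : nat} d' (T : measurableType d').
Implicit Types Z W : T -> 'rV[R]_d.

Definition coord_measurable Z :=
  forall i, measurable_fun setT (fun p => Z p ord0 i).

Lemma measurable_dot Z W : coord_measurable Z -> coord_measurable W ->
  measurable_fun setT (fun p => dot (Z p) (W p)).
Proof.
move=> mZ mW; under eq_fun do rewrite dotE.
by apply: measurable_sum => i; exact: measurable_funM.
Qed.

Lemma measurable_mul_reflection Z W : coord_measurable Z -> coord_measurable W ->
  coord_measurable (fun p => Z p *m reflection (W p)).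
Proof.
move=> mZ mW i; under eq_fun do rewrite mul_reflection !mxE.
apply: measurable_funB => //; apply: measurable_funM => //.
apply: measurable_funM; last exact: measurable_dot.
apply: measurable_funM => //.
(* On nonnegative reals the inverse, with value 0 at 0, is the power -1, known to be measurable. *)
under eq_fun do rewrite -powR_inv1 ?dot_ge0//.
apply: (measurableT_comp (measurable_powR _)).
exact: measurable_dot.
Qed.

End Coordinates.

Section Suspension.
Context {R : realType} {d : nat}.
Implicit Types (u : 'rV[R]_(1 + d)) (y : 'rV[R]_d).

Definition pole : 'rV[R]_(1 + d) := row_mx 1%:M 0.

Lemma dot_row_mx (a b : R) (y z : 'rV[R]_d) :
  dot (row_mx a%:M y : 'rV[R]_(1 + d)) (row_mx b%:M z) = a * b + dot y z.
Proof.
rewrite /dot tr_row_mx mul_row_col mxE; congr (_ + _).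
by rewrite tr_scalar_mx -scalar_mxM mxE eqxx mulr1n.
Qed.

Lemma pole_unit : unit_sphere pole.
Proof. by apply/unit_sphereP; rewrite dot_row_mx /dot mul0mx mxE mulr1 addr0. Qed.

Lemma orthogonal_block (k : 'M[R]_d) : orthogonal_mx k ->
  orthogonal_mx (block_mx 1%:M 0 0 k : 'M[R]_(1 + d)).
Proof.
move=> ok; rewrite /orthogonal_mx tr_block_mx mulmx_block !trmx0 trmx1.
by rewrite !(mul0mx, mulmx0, mulmx1, addr0, add0r) ok -scalar_mx_block.
Qed.

(** Fixing the pole makes the first row of [K] equal to that of the identity; orthogonality of the
    rows then kills the rest of the first column. *)
Lemma pole_stabilizer (K : 'M[R]_(1 + d)) : orthogonal_mx K ->
  pole *m K = pole -> exists2 k : 'M[R]_d, orthogonal_mx k &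
    forall (a : R) y, row_mx a%:M y *m K = row_mx a%:M (y *m k).
Proof.
rewrite -[K]submxK; set A := ulsubmx K; set B := ursubmx K.
set C := dlsubmx K; set D := drsubmx K.
move=> oK; rewrite mul_row_block !mul1mx !mul0mx !addr0 => /eq_row_mx[eA eB].
move: oK; rewrite eA eB /orthogonal_mx tr_block_mx mulmx_block trmx0 trmx1.
rewrite !(mul1mx, mulmx1, mul0mx, mulmx0, addr0) scalar_mx_block.
move=> /eq_block_mx[_ _ eC]; rewrite eC mul0mx add0r => oD.
exists D => // a y.
by rewrite mul_row_block !mulmx0 mulmx1 addr0 add0r.
Qed.

(** For [s ^+ 2 + t ^+ 2 = 1] and unit vectors [u], [y], this is the point at height [s] over the
    pole [u], in the direction [y] of its latitude sphere. *)
Definition suspend (s t : R) (z : borelRd R (1 + d) * borelRd R d) :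
    borelRd R (1 + d) :=
  row_mx s%:M (t *: (z.2 : 'rV[R]_d)) *m reflection (pole - (z.1 : 'rV[R]_(1 + d))).

(** Turns an orthogonal matrix acting on [y] into one acting on the whole vector; the induction on
    the dimension rests on this. *)
Lemma suspend_block s t u y (M : 'M[R]_d) :
  suspend s t (u, y *m M) = row_mx s%:M (t *: y) *m
    (block_mx 1%:M 0 0 M *m reflection (pole - u)).
Proof.
by rewrite mulmxA mul_row_block mulmx1 !mulmx0 addr0 add0r -scalemxAl.
Qed.

Lemma measurable_suspend s t : measurable_fun setT (suspend s t).
Proof.
apply: measurable_fun_rV; apply: measurable_mul_reflection => i.
  case: (split_ordP i) => j ->.
    under eq_fun do rewrite row_mxEl; exact: measurable_cst.
  under eq_fun do rewrite row_mxEr mxE.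
  apply: measurable_funM => //.
  by apply: (measurableT_comp (measurable_coord j)); exact: measurable_snd.
under eq_fun do rewrite !mxE.
apply: measurable_funB => //.
by apply: (measurableT_comp (measurable_coord i)); exact: measurable_fst.
Qed.

Variables (mu : probability (borelRd R (1 + d)) R) (nu : probability (borelRd R d) R).
Hypotheses (d2 : (2 <= d)%N) (hmu : sphere_measure mu) (hnu : sphere_measure nu).
Variables (s t : R).
Hypothesis st : s ^+ 2 + t ^+ 2 = 1.

Lemma measurable_suspend_preimage (A : set (borelRd R (1 + d))) :
  measurable A -> measurable (suspend s t @^-1` A).
Proof. by move=> mA; rewrite -[X in measurable X]setTI; exact: measurable_suspend. Qed.

Lemma suspend_unit (u : 'rV[R]_(1 + d)) (y : 'rV[R]_d) :
  unit_sphere y -> unit_sphere (suspend s t (u, y)).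
Proof.
rewrite unit_sphereP => hy; apply/(unit_sphere_orthogonal _ (reflection_orthogonal _)).
by rewrite unit_sphereP dot_row_mx dotZl dotZr hy mulr1 -!expr2.
Qed.

(** The reflection at [u] takes the pole to [u], [M] takes [u] to [u *m M], and the reflection at
    [u *m M] returns it to the pole. The composite thus acts only on the last [d] coordinates,
    through some [k]. *)
Lemma suspend_rotate (M : 'M[R]_(1 + d)) (u : 'rV[R]_(1 + d)) :
  rotation M -> unit_sphere u -> exists2 k : 'M[R]_d, orthogonal_mx k &
  forall y : 'rV[R]_d, suspend s t (u, y) *m M = suspend s t (u *m M, y *m k).
Proof.
move=> [oM _] uu; have uuM : unit_sphere (u *m M) by exact/unit_sphere_orthogonal.
pose H (v : 'rV[R]_(1 + d)) := reflection (pole - v).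
have oH v : orthogonal_mx (H v) := reflection_orthogonal _.
have HH v : H v *m H v = 1%:M by rewrite -[X in _ *m X]reflection_tr; exact: oH.
have HuM : pole *m (H u *m M *m H (u *m M)) = pole.
  rewrite !mulmxA (reflection_map pole_unit uu).
  by rewrite -{1}(reflection_map pole_unit uuM) -mulmxA HH mulmx1.
have oK : orthogonal_mx (H u *m M *m H (u *m M)).
  exact: orthogonalM (orthogonalM (oH _) oM) (oH _).
have [k ok kE] := pole_stabilizer oK HuM.
exists k => // y; rewrite /suspend/= scalemxAl -kE -!mulmxA.
by rewrite -/(H u) -/(H (u *m M)) HH mulmx1.
Qed.

Lemma suspend_law_invariant (M : 'M[R]_(1 + d)) (A : set (borelRd R (1 + d))) :
  rotation M -> measurable A ->
  (mu \x nu)%E (suspend s t @^-1` ((fun x : 'rV[R]_(1 + d) => x *m M) @^-1` A)) =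
  (mu \x nu)%E (suspend s t @^-1` A).
Proof.
move=> rM mA.
have mM := @measurable_fun_mulmx R (1 + d) M.
have mMA : measurable ((fun x : 'rV[R]_(1 + d) => x *m M) @^-1` A : set (borelRd R (1 + d))).
  by rewrite -[X in measurable X]setTI; exact: mM.
pose g (u : borelRd R (1 + d)) := nu (xsection (suspend s t @^-1` A) u).
have mg : measurable_fun setT g.
  by apply: measurable_fun_xsection; exact: measurable_suspend_preimage.
(* For fixed [u] on the sphere, the factor [k] is absorbed by the orthogonal invariance of [nu];
   afterwards [M] is absorbed by the invariance of [mu]. *)
transitivity (\int[mu]_u g ((u : 'rV[R]_(1 + d)) *m M))%E.
  apply: (@eq_integral_full _ _ _ mu (@unit_sphere R (1 + d))) => //.
  - exact: measurable_unit_sphere.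
  - by case: hmu.
  - by apply: measurable_fun_xsection; exact: measurable_suspend_preimage.
  - exact: (measurableT_comp mg mM).
  move=> u; rewrite inE => uu; have [k ok kE] := suspend_rotate rM uu.
  rewrite /g -(sphere_measure_orthogonal d2 hnu ok); last first.
    by apply: measurable_xsection; exact: measurable_suspend_preimage.
  congr (nu _); apply/seteqP; split => y; rewrite /= !xsectionE /= kE; exact.
transitivity (\int[pushforward mu (fun u : borelRd R (1 + d) =>
    ((u : 'rV[R]_(1 + d)) *m M) : borelRd R (1 + d))]_u g u)%E.
  by rewrite ge0_integral_pushforward// => u _; exact: measure_ge0.
apply: eq_measure_integral => B mB _.
by case: hmu => _ /(_ M B rM mB).
Qed.

(* Disintegration of [mu] over the latitude spheres around a random pole [u]. *)
Lemma suspend_integral (A : set (borelRd R (1 + d))) : measurable A ->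
  (\int[mu]_u nu [set y : 'rV[R]_d | A (suspend s t (u, y))] = mu A)%E.
Proof.
move=> mA; have mf := measurable_suspend s t.
pose P := distribution (mu \x nu)%E (mfun_Sub (mem_set mf)).
(* By uniqueness, the law of [suspend] is [mu] as soon as it is a sphere measure. *)
have hP : sphere_measure P.
  split; last by move=> M B rM mB; exact: suspend_law_invariant.
  have mS := @measurable_unit_sphere R d.
  have mS1 := @measurable_unit_sphere R (1 + d).
  apply/eqP; rewrite eq_le probability_le1//=.
  have -> : 1%E = (mu \x nu)%E ((@unit_sphere R (1 + d)) `*` (@unit_sphere R d)).
    rewrite product_measure1E//.
    rewrite -[LHS]mule1; congr (_ * _)%E; apply/esym.
      exact: (proj1 hmu).
    exact: (proj1 hnu).
  apply: le_measure; rewrite ?inE.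
  - exact: measurableX.
  - exact: measurable_suspend_preimage.
  - by move=> [u y] [_ /= uy]; exact: suspend_unit.
rewrite -(sphere_measure_unique _ hP hmu mA) ?(leq_trans d2)//.
apply: eq_integral => u _ /=; congr (nu _); apply/seteqP; split => y;
  by rewrite xsectionE.
Qed.

End Suspension.

(** * Averaging over rotations *)

Lemma sum_integral_le d (T : measurableType d) (R : realType)
    (P : probability T R) (S : set T) (I : finType) (f : I -> T -> \bar R)
    (c : \bar R) : measurable S -> P S = 1%E ->
  (forall k, measurable_fun setT (f k)) -> (forall k x, 0 <= f k x)%E ->
  (forall x, S x -> (\sum_k f k x <= c)%E) ->
  (\sum_k \int[P]_x f k x <= c)%E.
Proof.
move=> mS PS mf f0 fc.
(* Off [S] the restricted sum is 0, and this must still be at most [c]. *)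
have c0 : (0 <= c)%E.
  have [x Sx] : exists x, S x.
    apply/not_existsP => noS; move: PS; rewrite (_ : S = set0) ?measure0.
      by move/esym/eqP; rewrite onee_eq0.
    by rewrite -subset0.
  by apply: le_trans (fc x Sx); exact: sume_ge0.
rewrite -ge0_integral_sum//.
pose F x := (\sum_k f k x)%E.
have mF : measurable_fun setT F by exact: emeasurable_sum.
rewrite (@eq_integral_full _ _ _ _ S _ (F \_ S))//; last first.
- by move=> x xS; rewrite patchE xS.
- apply/(measurable_restrictT _ mS).
  exact: measurable_funS mF.
rewrite -[leRHS]mule1 -(probability_setT P) -integral_cst//.
apply: ge0_le_integral => //.
- by move=> x _; rewrite patchE; case: ifP => // _; exact: sume_ge0.
- apply/(measurable_restrictT _ mS).
  exact: measurable_funS mF.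
- by move=> x _; rewrite patchE; case: ifPn => //; rewrite inE => /fc.
Qed.

Lemma eq_mem_set (T1 T2 : Type) (A : set T1) (B : set T2) (a : T1) (b : T2) :
  A a = B b -> (a \in A) = (b \in B).
Proof. by move=> AB; apply/idP/idP; rewrite !inE AB. Qed.

Section Circle.
Context {R : realType}.

(* Right multiplication by the complex number [x]. *)
Definition complex_mx (x : 'rV[R]_2) : 'M[R]_2 := \matrix_(i, j)
  (if i == ord0 then x ord0 j else if j == ord0 then - x ord0 ord_max else x ord0 ord0).

(** Commutativity of complex multiplication: turning a fixed vector by a random one is turning the
    random one by the fixed one. *)
Lemma complex_mxC (x y : 'rV[R]_2) : x *m complex_mx y = y *m complex_mx x.
Proof.
apply/rowP => j; rewrite !mxE !big_ord_recl !big_ord0 !mxE /=.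
have -> : lift ord0 ord0 = ord_max :> 'I_2 by apply/val_inj.
by have [->|] := eqVneq j ord0; [|case: j => [[|[|//]]] //= ij _;
  rewrite (_ : Ordinal ij = ord_max); last exact/val_inj]; ring.
Qed.

Lemma complex_mx_orthogonal (x : 'rV[R]_2) : unit_sphere x ->
  orthogonal_mx (complex_mx x).
Proof.
rewrite unit_sphereP dot_sqr !big_ord_recl big_ord0.
have -> : lift ord0 ord0 = ord_max :> 'I_2 by apply/val_inj.
rewrite addr0 => ux; apply/matrixP => i j.
rewrite !mxE !big_ord_recl big_ord0 !mxE /=.
have -> : lift ord0 ord0 = ord_max :> 'I_2 by apply/val_inj.
case: i => [[|[|//]]] ii; case: j => [[|[|//]]] jj /=; rewrite -?val_eqE/= ?mulr1n ?mulr0n.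
- by rewrite addr0 -!expr2.
- by ring.
- by ring.
- by rewrite addr0 -!expr2 sqrrN addrC.
Qed.

End Circle.

Section Averaging.
Context {R : realType} (sigma : forall d : nat, probability (borelRd R d) R).
Hypothesis hsigma : forall d : nat, (2 <= d)%N -> sphere_measure (sigma d).

(* For Haar-distributed [M], the mean of the left-hand side of the hypothesis is
   the left-hand side of the conclusion; the induction on the dimension
   replaces the Haar measure. *)
Lemma rotation_averaging d (I : finType) (v : I -> 'rV[R]_d.+2)
    (A : I -> set (borelRd R d.+2)) (c : \bar R) :
  (forall k, unit_sphere (v k)) -> (forall k, measurable (A k)) ->
  (forall M, orthogonal_mx M -> (\sum_k (\1_(A k) (v k *m M))%:E <= c)%E) ->
  (\sum_k sigma d.+2 (A k) <= c)%E.
Proof.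
elim: d I v A => [|d IH] I v A uv mA hc.
  (* On the circle the average runs over [complex_mx x] with [x] uniform; by commutativity it
     carries [v k] to the uniform point [x *m complex_mx (v k)]. *)
  pose B k : set (borelRd R 2) := (fun x : 'rV[R]_2 => x *m complex_mx (v k)) @^-1` A k.
  have mB k : measurable (B k).
    by rewrite -[X in measurable X]setTI; exact: measurable_fun_mulmx.
  have -> : (\sum_k sigma 2 (A k) = \sum_k \int[sigma 2]_x (\1_(B k) x)%:E)%E.
    apply: eq_bigr => k _; rewrite integral_indic// setIT.
    rewrite -(@sphere_measure_orthogonal _ _ _ _ (complex_mx (v k)))//.
      exact: hsigma.
    exact: complex_mx_orthogonal.
  apply: (@sum_integral_le _ (borelRd R 2) R (sigma 2) (@unit_sphere R 2) I
    (fun k x => (\1_(B k) x)%:E)).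
  - exact: measurable_unit_sphere.
  - by case: (hsigma (leqnn 2)).
  - move=> k; apply/measurable_EFinP; exact: measurable_indic.
  - by move=> k x; rewrite lee_fin.
  move=> x ux; apply: le_trans (hc _ (complex_mx_orthogonal ux)).
  apply: lee_sum => k _; rewrite lee_fin !indicE.
  by rewrite (@eq_mem_set _ _ (B k) (A k) x (v k *m complex_mx x))// /B /= complex_mxC.
have hS : sphere_measure (sigma d.+3) by exact: hsigma.
have hN : sphere_measure (sigma d.+2) by exact: hsigma.
(* Each [v k] is split as [(s, t w)] with [w] a unit vector one dimension below; if [t = 0], any
   unit vector serves as [w]. *)
pose V k : 'rV[R]_(1 + d.+2) := v k.
pose s k : R := lsubmx (V k) ord0 ord0.
pose t k : R := Num.sqrt (dot (rsubmx (V k)) (rsubmx (V k))).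
pose e : 'rV[R]_d.+2 := delta_mx ord0 ord0.
have ue : unit_sphere e.
  apply/unit_sphereP; rewrite /dot trmx_delta mul_delta_mx_cond eqxx mulr1n.
  by rewrite mxE !eqxx.
pose w k : 'rV[R]_d.+2 := if t k == 0 then e else (t k)^-1 *: rsubmx (V k).
have t2 k : t k ^+ 2 = dot (rsubmx (V k)) (rsubmx (V k)) by rewrite sqr_sqrtr// dot_ge0.
have uw k : unit_sphere (w k).
  rewrite /w; case: ifPn => // t0; apply/unit_sphereP.
  by rewrite dotZl dotZr -t2 expr2 mulKf// mulVf.
have tw k : t k *: w k = rsubmx (V k).
  rewrite /w; case: ifPn => [/eqP t0|t0]; last by rewrite scalerA divff// scale1r.
  by rewrite t0 scale0r; apply/esym/dot_eq0; rewrite -t2 t0 expr0n.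
have vE k : V k = row_mx (s k)%:M (t k *: w k).
  by rewrite tw -[LHS]hsubmxK; congr row_mx; exact: mx11_scalar.
have st k : s k ^+ 2 + t k ^+ 2 = 1.
  have /unit_sphereP := uv k; rewrite -/(V k) vE dot_row_mx => <-.
  by rewrite tw -t2 expr2.
pose C k u : set (borelRd R d.+2) := [set y : 'rV[R]_d.+2 | A k (suspend (s k) (t k) (u, y))].
have CE k u : C k u = xsection (suspend (s k) (t k) @^-1` A k) u.
  by apply/seteqP; split => y; rewrite xsectionE.
have mC k u : measurable (C k u).
  by rewrite CE; apply: measurable_xsection; exact: measurable_suspend_preimage.
have -> : (\sum_k sigma d.+3 (A k) = \sum_k \int[sigma d.+3]_u sigma d.+2 (C k u))%E.
  by apply: eq_bigr => k _; rewrite -(@suspend_integral _ _ _ (sigma d.+2) _ _ _ (s k) (t k)).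
apply: (@sum_integral_le _ (borelRd R d.+3) R (sigma d.+3) setT I
  (fun k u => sigma d.+2 (C k u))) => //.
- exact: probability_setT.
- move=> k; under eq_fun do rewrite CE.
  by apply: measurable_fun_xsection; exact: measurable_suspend_preimage.
(* For fixed [u] the induction hypothesis averages over [M]; its premise is [hc] at the block matrix
   of [M] followed by the reflection at [u]. *)
move=> u _; apply: (IH _ w) => // M oM.
have := hc (block_mx 1%:M 0 0 M *m reflection (pole - (u : 'rV[R]_(1 + d.+2)))).
move=> /(_ (orthogonalM (orthogonal_block oM) (reflection_orthogonal _))).
apply: le_trans; apply: lee_sum => k _; rewrite lee_fin !indicE.
rewrite (@eq_mem_set _ _ (C k u) (A k) (w k *m M) (v k *m (block_mx 1%:M 0 0 M *m
   reflection (pole - (u : 'rV[R]_(1 + d.+2))))))//.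
by congr (A k _); rewrite suspend_block -vE.
Qed.

End Averaging.

(** * Triangle-free digraphs and the lexicographic hemisphere *)

Section Digraph.
Context (T : finType) (E : rel T).
Hypothesis noC3 : forall x y z, ~~ [&& E x y, E y z & E z x].

Lemma sum_two_out (V : {set T}) (x y : T) (f : T -> nat) : x \in V -> y \in V ->
  x != y -> (\sum_(z in V) f z = f x + f y + \sum_(z in V :\: [set x; y]) f z)%N.
Proof.
move=> xV yV xy; rewrite (big_setD1 x)//= (big_setD1 y)/= ?addnA; last first.
  by rewrite in_setD1 eq_sym xy.
by congr (_ + _)%N; apply: eq_bigl => z; rewrite !inE negb_or andbA [in RHS](andbC (z != x)).
Qed.

(* The induction removes the two ends of a digon: at most two arcs join them to any
   third vertex. Without digons each pair of vertices carries at most one arc. *)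
Lemma C3free_arcs (V : {set T}) :
  (2 * \sum_(x in V) \sum_(y in V) E x y <= #|V| ^ 2)%N.
Proof.
have [n] := ubnP #|V|; elim: n V => // n IH V ltVn.
have loopless x : E x x = false by have := noC3 x x x; case: (E x x).
have [/existsP[x /existsP[y /and4P[xV yV Exy Eyx]]]|noC2] :=
  boolP [exists x, exists y, [&& x \in V, y \in V, E x y & E y x]].
  have xy : x != y by apply: contraTneq Exy => ->; rewrite loopless.
  set W := V :\: [set x; y].
  have cV : #|V| = #|W|.+2.
    rewrite -sum1_card (sum_two_out _ xV yV xy) sum1_card -/W; lia.
  have {}IH := IH W _.
  have hz z : (E x z + E y z + (E z x + E z y) <= 2)%N.
    have := noC3 x y z; have := noC3 y x z; rewrite Exy Eyx /=.
    by case: (E x z); case: (E y z); case: (E z x); case: (E z y).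
  rewrite (sum_two_out _ xV yV xy).
  rewrite !(sum_two_out _ xV yV xy) !loopless Exy Eyx -/W.
  have -> : (\sum_(z in W) \sum_(t in V) E z t = \sum_(z in W) (E z x + E z y)
      + \sum_(z in W) \sum_(t in W) E z t)%N.
    rewrite -big_split/=; apply: eq_bigr => z _.
    by rewrite (sum_two_out _ xV yV xy).
  have : (\sum_(z in W) E x z + \sum_(z in W) E y z + \sum_(z in W) (E z x + E z y)
      <= 2 * #|W|)%N.
    rewrite -!big_split/= mulnC -sum_nat_const; apply: leq_sum => z _; exact: hz.
  (* The digon has 2 arcs and at most [2 * #|W|] arcs join it to [W], so the doubled count is at
     most [4 + 4 * #|W| + #|W| ^ 2], the square of [#|W| + 2]. *)
  have := IH ltac:(lia); rewrite cV; nia.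
rewrite mul2n -addnn [X in (_ + X)%N]exchange_big/= -big_split/=.
rewrite expnS expn1 -sum_nat_const; apply: leq_sum => x xV.
rewrite -big_split/= -sum1_card; apply: leq_sum => y yV.
move/existsPn/(_ x)/existsPn/(_ y): noC2; rewrite xV yV/=.
by case: (E x y); case: (E y x).
Qed.

End Digraph.

Section Lexicographic.
Context {R : realType} {d : nat}.

Definition lex_positive : set (borelRd R d) :=
  [set x : 'rV[R]_d | exists2 i, 0 < x ord0 i & forall j : 'I_d, (j < i)%N -> x ord0 j = 0].

Lemma measurable_lex_positive : measurable lex_positive.
Proof.
have -> : lex_positive = \bigcup_(i in [set: 'I_d])
    ((fun x : borelRd R d => (x : 'rV[R]_d) ord0 i) @^-1` `]0, +oo[%classic `&`
     \bigcap_(j in [set j : 'I_d | (j < i)%N])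
       (fun x : borelRd R d => (x : 'rV[R]_d) ord0 j) @^-1` [set 0]).
  apply/seteqP; split => [x [i xi xj]|x [i _ [/= xi xj]]].
    by exists i => //; split=> //=; rewrite in_itv/= xi.
  by exists i => //; move: xi; rewrite in_itv/= andbT.
apply: fin_bigcup_measurable => // i _; apply: measurableI.
  by rewrite -[X in measurable X]setTI; exact: measurable_coord.
apply: fin_bigcap_measurable => // j _.
by rewrite -[X in measurable X]setTI; exact: measurable_coord.
Qed.

(** At the least of the three leading indices one vector has a positive coordinate and the other two
    nonnegative ones. *)
Lemma lex_positive_zero_sum_free : zero_sum_free lex_positive.
Proof.
move=> [x [y [z [[i xi xl] [j yj yl] [k zk zl] xyz]]]].
have nonneg (m l : 'I_d) (u : 'rV[R]_d) : 0 < u ord0 m ->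
    (forall j : 'I_d, (j < m)%N -> u ord0 j = 0) -> (l <= m)%N -> 0 <= u ord0 l.
  move=> um ul; rewrite leq_eqVlt => /orP[/eqP/val_inj ->|/ul ->//]; exact: ltW.
have eq0 l : x ord0 l + y ord0 l + z ord0 l = 0.
  by move/rowP/(_ l): xyz; rewrite !mxE.
have hi : (i <= j)%N -> (i <= k)%N -> False.
  move=> /(nonneg _ _ _ yj yl) ? /(nonneg _ _ _ zk zl) ?; have := eq0 i; lra.
have hj : (j <= i)%N -> (j <= k)%N -> False.
  move=> /(nonneg _ _ _ xi xl) ? /(nonneg _ _ _ zk zl) ?; have := eq0 j; lra.
have hk : (k <= i)%N -> (k <= j)%N -> False.
  move=> /(nonneg _ _ _ xi xl) ? /(nonneg _ _ _ yj yl) ?; have := eq0 k; lra.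
have [ij|ji] := leqP i j; have [ik|ki] := leqP i k; have [jk|kj] := leqP j k.
all: try exact: hi; try (exact: hj (ltnW _) _); lia.
Qed.

Lemma lex_positive_total (x : 'rV[R]_d) : x != 0 -> lex_positive x \/ lex_positive (- x).
Proof.
move=> /rV0Pn[i0 xi0].
case: (@arg_minnP _ i0 (fun i => x ord0 i != 0) (@nat_of_ord d) xi0) => i xi imin.
have xl (j : 'I_d) : (j < i)%N -> x ord0 j = 0.
  by move=> ji; apply/eqP; apply: contraTT ji => /imin; rewrite -leqNgt.
have := xi; rewrite neq_lt => /orP[xn|xp]; [right|left]; exists i => //.
  by rewrite mxE oppr_gt0.
by move=> j /xl; rewrite mxE => ->; rewrite oppr0.
Qed.

(** The antipodal map is orthogonal, though not a rotation for odd [d], so both halves have equal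
    measure. *)
Lemma half_le_lex_positive (mu : probability (borelRd R d) R) : (2 <= d)%N ->
  sphere_measure mu ->
  ((2^-1)%:E <= mu (lex_positive `&` (@unit_sphere R d)))%E.
Proof.
move=> d2 hmu.
have mL := measurable_lex_positive; have mS := @measurable_unit_sphere R d.
rewrite (probability_setI1 mL mS); last by case: hmu.
pose N : set (borelRd R d) := (fun x : 'rV[R]_d => x *m (- 1%:M)) @^-1` lex_positive.
have mN : measurable N.
  by rewrite -[X in measurable X]setTI; exact: measurable_fun_mulmx.
have muN : mu N = mu lex_positive.
  by apply: sphere_measure_orthogonal => //; exact: orthogonalN1.
have : (1 <= mu lex_positive + mu lex_positive)%E.
  rewrite -{2}muN -(proj1 hmu).
  apply: le_trans (measureU2 _ mL mN); apply: le_measure; rewrite ?inE//.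
    exact: measurableU.
  move=> x ux; have : (x : 'rV[R]_d) != 0.
    apply/eqP => x0; move: ux => /unit_sphereP; rewrite x0 /dot mul0mx mxE.
    by move/esym/eqP; rewrite oner_eq0.
  by case/lex_positive_total; [left|right; rewrite /N /= mulmxN mulmx1].
have : mu lex_positive \is a fin_num by exact: fin_num_measure.
by move=> /fineK <-; rewrite -EFinD !lee_fin; lra.
Qed.

End Lexicographic.

(** * The two bounds *)

Section UpperBound.
Context {R : realType} (sigma : forall d : nat, probability (borelRd R d) R).
Hypothesis hsigma : forall d : nat, (2 <= d)%N -> sphere_measure (sigma d).

Definition basis_row d (i : 'I_d) : 'rV[R]_d := delta_mx ord0 i.

Lemma dot_basis d (i j : 'I_d) : dot (basis_row i) (basis_row j) = (i == j)%:R.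
Proof.
by rewrite /dot trmx_delta mul_delta_mx_cond mulrb; case: eqP; rewrite !mxE ?eqxx.
Qed.

(* Normalized roots of type A; for [i = j] an arbitrary unit vector. *)
Definition rootA d (i j : 'I_d.+1) : 'rV[R]_d.+1 :=
  if i == j then basis_row ord0
  else (Num.sqrt 2)^-1 *: (basis_row i - basis_row j).

Lemma rootA_unit d (i j : 'I_d.+1) : unit_sphere (rootA i j).
Proof.
apply/unit_sphereP; rewrite /rootA; case: ifPn => [_|ij].
  by rewrite dot_basis eqxx.
rewrite dotZl dotZr !(dotDl, dotDr, dotNl, dotNr) !dot_basis !eqxx.
rewrite (eq_sym j) (negbTE ij) /= oppr0 addr0 sub0r opprK mulrA -invfM -expr2.
by rewrite sqr_sqrtr// mulVf.
Qed.

Lemma zero_sum_free_bound d (A : set (borelRd R d.+2)) : measurable A ->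
  zero_sum_free A ->
  (sigma d.+2 A <= (2^-1 + 2^-1 * d.+1%:R^-1)%:E)%E.
Proof.
move=> mA zA.
(* The empty set on the diagonal keeps the arbitrary vectors [rootA i i] from counting. *)
pose B (p : 'I_d.+2 * 'I_d.+2) : set (borelRd R d.+2) := if p.1 == p.2 then set0 else A.
have mB p : measurable (B p) by rewrite /B; case: ifP.
have := @rotation_averaging R sigma hsigma d _ (fun p => rootA p.1 p.2) B
  (2^-1 * d.+2%:R ^+ 2)%:E (fun p => rootA_unit _ _) mB.
have -> : (\sum_p sigma d.+2 (B p) =
    (fine (sigma d.+2 A) *+ d.+1 *+ d.+2)%:E)%E.
  under eq_bigr => p _.
    rewrite (_ : sigma _ _ = (if p.1 == p.2 then 0 else fine (sigma d.+2 A))%:E).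
      over.
    rewrite /B; case: ifP => _; first by rewrite measure0.
    by rewrite fineK// fin_num_measure.
  rewrite sumEFin -(pair_bigA _ (fun i j : 'I_d.+2 =>
    if i == j then 0 else fine (sigma d.+2 A)))/=; congr (_%:E).
  rewrite (eq_bigr (fun=> fine (sigma d.+2 A) *+ d.+1)).
    by rewrite sumr_const card_ord.
  move=> i _; rewrite (bigD1 i)//= eqxx add0r.
  rewrite (eq_bigr (fun=> fine (sigma d.+2 A))).
    by rewrite sumr_const (eq_card (B := predC1 i))// cardC1 card_ord.
  by move=> j; rewrite eq_sym => /negbTE ->.
have sA : sigma d.+2 A \is a fin_num by rewrite fin_num_measure.
move=> H; have {H} : (fine (sigma d.+2 A) *+ d.+1 *+ d.+2 <= 2^-1 * d.+2%:R ^+ 2).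
  rewrite -lee_fin; apply: H => M oM.
  pose E (i j : 'I_d.+2) := (i != j) && (rootA i j *m M \in A).
  rewrite sumEFin lee_fin.
  have -> : \sum_p \1_(B p) (rootA p.1 p.2 *m M) = (\sum_i \sum_j E i j)%:R :> R.
    rewrite natr_sum; under [RHS]eq_bigr do rewrite natr_sum.
    rewrite pair_bigA/=; apply: eq_bigr => -[i j] _; rewrite indicE /B /E/=.
    by case: eqP => //= _; rewrite in_set0.
  have noC3 i j k : ~~ [&& E i j, E j k & E k i].
    apply/negP => /and3P[/andP[ij Aij] /andP[jk Ajk] /andP[ki Aki]]; apply: zA.
    exists (rootA i j *m M), (rootA j k *m M), (rootA k i *m M).
    split; [exact: set_mem Aij|exact: set_mem Ajk|exact: set_mem Aki|].
    (* Around a directed triangle the differences of basis vectors telescope to 0. *)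
    rewrite -!mulmxDl /rootA (negbTE ij) (negbTE jk) (negbTE ki) -!scalerDr.
    by rewrite !addrA !subrK subrr scaler0 mul0mx.
  have -> : (\sum_i \sum_j E i j =
      \sum_(i in [set: 'I_d.+2]%SET) \sum_(j in [set: 'I_d.+2]%SET) E i j)%N.
    apply: eq_big => [i|i _]; first by rewrite !inE.
    by apply: eq_bigl => j; rewrite !inE.
  have := C3free_arcs noC3 [set: 'I_d.+2]%SET; rewrite cardsT card_ord.
  by rewrite ler_pdivlMl// -natrM -natrX ler_nat.
(* Dividing by the number [(d + 2)(d + 1)] of ordered pairs leaves [(d + 2) / (2 (d + 1))], which is
   the stated bound. *)
move=> h0; have h : fine (sigma d.+2 A) * d.+1%:R * d.+2%:R <= 2^-1 * d.+2%:R ^+ 2.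
  by rewrite !(mulr_natr _ d.+1, mulr_natr _ d.+2).
rewrite -(fineK sA) lee_fin.
have d1 : 0 < d.+1%:R :> R by [].
rewrite -(ler_pM2r d1) mulrDl divfK ?gt_eqF//.
have : fine (sigma d.+2 A) * d.+1%:R <= 2^-1 * d.+2%:R.
  by rewrite -(ler_pM2r (ltr0Sn _ d.+1)) -(mulrA 2^-1) -expr2.
by rewrite -(natr1 d.+1) mulrDr mulr1.
Qed.

End UpperBound.

Unset Implicit Arguments.

Theorem mainTheorem2 (R : realType)
    (sigma : forall d : nat, probability (borelRd R d) R)
    (sigma_sphere : forall d : nat, (2 <= d)%N -> sphere_measure (sigma d)) :
  max_zero_sum_free (sigma d) @[d --> \oo] --> (2^-1)%:E.
Proof.
have lower d : ((2^-1)%:E <= max_zero_sum_free (sigma d.+2))%E.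
  apply: le_trans (half_le_lex_positive _ (sigma_sphere d.+2 _)) _ => //.
  apply: ereal_sup_ubound; exists (lex_positive `&` @unit_sphere R d.+2) => //; split.
  - apply: measurableI; first exact: measurable_lex_positive.
    exact: measurable_unit_sphere.
  - exact: subIsetr.
  - move=> [x [y [z [[xL _] [yL _] [zL _] xyz]]]].
    by apply: (@lex_positive_zero_sum_free R d.+2); exists x, y, z.
have upper d : (max_zero_sum_free (sigma d.+2) <= (2^-1 + 2^-1 * d.+1%:R^-1)%:E)%E.
  by apply: ge_ereal_sup => _ [A [mA _ zA] <-]; exact: zero_sum_free_bound.
have cvg_upper : (2^-1 + 2^-1 * n.+1%:R^-1 : R)%:E @[n --> \oo] --> (2^-1)%:E.
  apply: cvg_EFin; first exact: nearW.
  rewrite -[X in _ --> X]addr0 -(mulr0 2^-1).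
  apply: cvgD; first exact: cvg_cst.
  by apply: cvgMl_tmp; exact: cvg_harmonic.
have cvg_shift : max_zero_sum_free (sigma n.+2) @[n --> \oo] --> (2^-1)%:E.
  apply: squeeze_cvge (cvg_cst _) cvg_upper.
  by apply: nearW => d; rewrite lower upper.
(* The hypothesis on [sigma] starts at dimension 2, hence the shift of the sequence. *)
rewrite -(cvg_shiftn 2).
by under eq_fun do rewrite addn2.
Qed.
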